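(* Let $\eta$ be a random variable taking values in $\{0,1,2,\dots\}\cup\{\infty\}$ with $P(\eta=0)<1$. If $(p_n)_{n\in\mathbb{N}}$ is a sequence in $(0,1]$ with $\lim_{n\to\infty}p_n=1$, then for every $\epsilon\in(0,1)$, \[\lim_{n\to\infty}P\big(V_\infty(\mathcal{K}_n,p_n)\geq (1-\epsilon)n\big)=1.\]
   Context: Frog model on the complete graph: $\mathcal{K}_n=(\mathcal{V}_n,\mathcal{E}_n)$ is the complete graph on $n$ vertices (every pair of distinct vertices joined by an edge), with a distinguished vertex $o$ called the root. Let $\{\eta_v\}_{v\in\mathcal{V}_n}$ be i.i.d. copies of $\eta$. Initially each vertex $v\neq o$ carries $\eta_v$ inactive particles and $o$ carries $1+\eta_o$ active particles. At each instant of time, independently of everything else, each active particle survives with probability $p$ and otherwise dies (is permanently removed); a surviving active particle performs one step of simple random walk on $\mathcal{K}_n$ (jumps to a uniformly chosen vertex different from its current one), activating all inactive particles at the vertex it reaches. Inactive particles stay put until activated. A vertex is visited if some active particle is ever at it (the root is visited). $V_\infty(\mathcal{K}_n,p)$ is the total number of visited vertices once no active particles remain; in the cases $P(\eta=\infty)>0$ or $p=1$ one sets $V_\infty(\mathcal{K}_n,p):=n$. *)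

(* Defs.v *)
From HB Require Import structures.
From mathcomp Require Import all_boot all_order all_algebra.
From mathcomp Require Import all_classical all_reals all_analysis.
Set Implicit Arguments. Unset Strict Implicit. Unset Printing Implicit Defensive.
Import Order.TTheory GRing.Theory Num.Theory.
Local Open Scope classical_set_scope.
Local Open Scope ring_scope.

(* Frog model on the complete graph K_N with vertex set 'I_N, realised in the
   standard particle-wise way.  For each vertex v and each particle index j
   (particle j of vertex v) and each step k we have:
   - surv v j k : the coin deciding whether the particle survives its
     (k+1)-th instant of activity (true = survives, probability p);
   - jump v j k : a uniform element of 'I_N.-1, the (k+1)-th step of the walk
     goes from the current position x to  lift x (jump v j k), i.e. to a
     uniformly chosen vertex different from x.
   eta v : the number of sleeping particles at v (None = infinity). *)

Section Frog.
Variables (T : Type) (N : nat).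
Variables (eta : 'I_N -> T -> option nat)
          (surv : 'I_N -> nat -> nat -> T -> bool)
          (jump : 'I_N -> nat -> nat -> T -> 'I_N.-1).

Fixpoint frog_pos (v : 'I_N) (j : nat) (t : T) (k : nat) : 'I_N :=
  match k with
  | 0 => v
  | k'.+1 => lift (frog_pos v j t k') (jump v j k' t)
  end.

Definition frog_particle (o v : 'I_N) (j : nat) (t : T) : Prop :=
  match eta v t with
  | None => True
  | Some e => (j < e + (v == o))%N
  end.

Inductive frog_visited (o : 'I_N) (t : T) : 'I_N -> Prop :=
| frog_visited_root : frog_visited o t o
| frog_visited_step (v : 'I_N) (j k : nat) :
    frog_visited o t v -> frog_particle o v j t ->
    (forall i, (i <= k)%N -> surv v j i t) ->
    frog_visited o t (frog_pos v j t k.+1).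

End Frog.

(* V_infty(K_N, p): set to N when P(eta = oo) > 0 or p = 1. *)
Definition frog_V (R : realType) (T : Type) (N : nat) (qinf : R) (p : R)
  eta surv jump (o : 'I_N) (t : T) : nat :=
  if (0 < qinf) || (p == 1) then N
  else #|[set v : 'I_N | `[< frog_visited eta surv jump o t v >] ]|.

Inductive frog_cst (N : nat) :=
| CEta of 'I_N & option nat
| CSurv of 'I_N & nat & nat & bool
| CJump of 'I_N & nat & nat & 'I_N.-1.

Definition frog_key N (c : frog_cst N) : nat * ('I_N * nat * nat) :=
  match c with
  | CEta v _ => (0%N, (v, 0%N, 0%N))
  | CSurv v j k _ => (1%N, (v, j, k))
  | CJump v j k _ => (2%N, (v, j, k))
  end.

Definition frog_event (T : Type) (N : nat) eta surv jump (c : frog_cst N)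
  : set T :=
  match c with
  | CEta v x => [set t | eta v t = x]
  | CSurv v j k b => [set t | surv v j k t = b]
  | CJump v j k y => [set t | jump v j k t = y]
  end.

Definition frog_law (R : realType) (d : measure_display) (T : measurableType d)
  (P : probability T R) (N : nat) (q : option nat -> R) (p : R)
  (eta : 'I_N -> T -> option nat) (surv : 'I_N -> nat -> nat -> T -> bool)
  (jump : 'I_N -> nat -> nat -> T -> 'I_N.-1) : Prop :=
  [/\ (forall c : frog_cst N, measurable (frog_event eta surv jump c)),
      (forall s : seq (frog_cst N), uniq (map (@frog_key N) s) ->
         P (foldr (fun c A => frog_event eta surv jump c `&` A) setT s)
         = (\prod_(c <- s) P (frog_event eta surv jump c))%E),
      (forall v x, P [set t | eta v t = x] = (q x)%:E),
      (forall v j k, P [set t | surv v j k t] = p%:E) &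
      (forall v j k y, P [set t | jump v j k t = y] = (N.-1%:R)^-1%:E)].

(* Main.v *)
(** Explore the graph with particle 0 of each vertex only, revealing coins and
    jumps when they are needed. Let A be the explored vertices, W the vertices
    known to be visited, r = (1 + q(0)) / 2 < 1 and c = 1 - eps (1 - r). As long
    as |W| < (1 - eps) N, each jump hits a new vertex with probability at least
    eps, so it multiplies r^|W \ A| on average by at most c. Hence, when the
    current particle still has l steps to try, the probability that fewer than
    (1 - eps) N vertices are visited is at most r^|W \ A| (c^l + l (1 - p)), the
    second summand paying for a death. Launching L steps from a vertex of W \ A
    replaces a factor r by q(0) + (1 - q(0)) (c^L + L (1 - p)), which is at most
    r once the bracket is at most 1/2: this holds for a fixed large L and p
    close to 1. Running the root particle for M steps, the failure probability
    is at most c^M + M (1 - p): choose M large first, then p close to 1. *)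

Require Import Defs.
From HB Require Import structures.
From mathcomp Require Import all_boot all_order all_algebra.
From mathcomp Require Import all_classical all_reals all_analysis.
From mathcomp Require Import lra ring.
Import Order.TTheory GRing.Theory Num.Theory numFieldNormedType.Exports.
Local Open Scope classical_set_scope.
Local Open Scope ring_scope.

Set Implicit Arguments.
Unset Strict Implicit.
Unset Printing Implicit Defensive.

(** * Revealing independent coordinates *)

Section Cylinders.
Variables (R : realType) (d : measure_display) (T : measurableType d).
Variables (P : probability T R) (N : nat) (q : option nat -> R) (p : R).
Variables (eta : 'I_N -> T -> option nat)
  (surv : 'I_N -> nat -> nat -> T -> bool)
  (jump : 'I_N -> nat -> nat -> T -> 'I_N.-1).

Let ev := frog_event eta surv jump.
Let cyl (s : seq (frog_cst N)) : set T := foldr (fun c A => ev c `&` A) setT s.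

(** Real values let the later estimates be closed by [ring] and [lra]. *)
Definition pr (A : set T) : R := fine (P A).

Lemma prE {A} : measurable A -> P A = (pr A)%:E.
Proof. by move=> mA; rewrite fineK// fin_num_measure. Qed.

Lemma pr_ge0 A : 0 <= pr A.
Proof. by rewrite fine_ge0. Qed.

Lemma pr_setDI {A B} : measurable A -> measurable B ->
  pr A = pr (A `\` B) + pr (A `&` B).
Proof.
move=> mA mB; apply: EFin_inj; rewrite EFinD -!prE//.
- exact: measureDI.
- exact: measurableI.
- exact: measurableD.
Qed.

Lemma pr_le {A B} : measurable A -> measurable B -> A `<=` B -> pr A <= pr B.
Proof. by move=> mA mB AB; rewrite -lee_fin -!prE// le_measure// inE. Qed.

Lemma pr_fibers {n} (f : T -> 'I_n) {A} : measurable A ->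
  (forall y, measurable [set t | f t = y]) ->
  pr A = \sum_y pr (A `&` [set t | f t = y]).
Proof.
move=> mA mf; have mAf y : measurable (A `&` [set t | f t = y]).
  exact: measurableI.
have defA : A = \big[setU/set0]_(y < n) (A `&` [set t | f t = y]).
  apply/seteqP; split=> t.
    move=> At; rewrite -bigcup_seq; exists (f t) => //=.
    by rewrite mem_index_enum.
  by rewrite -bigcup_seq => -[y _ []].
apply: EFin_inj; rewrite -sumEFin -prE// {1}defA measure_semi_additive_ord//.
- by apply: eq_bigr => y _; rewrite -prE.
- apply/trivIsetP => i j _ _ ij; rewrite -subset0 => t [[_ /= ti] [_ /= tj]].
  by move: ij; rewrite -ti -tj eqxx.
- exact: bigsetU_measurable.
Qed.

Hypothesis law : frog_law P q p eta surv jump.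

Lemma measurable_ev c : measurable (ev c).
Proof. by case: law. Qed.

Lemma measurable_cyl s : measurable (cyl s).
Proof.
by elim: s => [|c s IH] //=; apply: measurableI => //; exact: measurable_ev.
Qed.

Lemma pr_eta v x : pr (ev (CEta v x)) = q x.
Proof. by case: law => _ _ h _ _; rewrite /pr h. Qed.

Lemma pr_surv v j k : pr (ev (CSurv v j k true)) = p.
Proof. by case: law => _ _ _ h _; rewrite /pr [P _]h. Qed.

Lemma pr_jump v j k y : pr (ev (CJump v j k y)) = N.-1%:R^-1.
Proof. by case: law => _ _ _ _ h; rewrite /pr h. Qed.

Let keys : Type := nat * ('I_N * nat * nat).

(* H is the past and F the set of keys that have not been looked at. *)
Definition revealed (H : set T) (F : pred keys) :=
  measurable H /\ forall s, uniq (map (@frog_key N) s) ->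
    all F (map (@frog_key N) s) ->
    pr (H `&` cyl s) = pr H * \prod_(c <- s) pr (ev c).

Lemma revealed_setT : revealed setT predT.
Proof.
split=> // s us _; have [_ indep _ _ _] := law.
have prs : P (cyl s) = (\prod_(c <- s) pr (ev c))%:E.
  rewrite indep// (big_morph EFin (@EFinM R) (erefl _)).
  by apply: eq_bigr => c _; rewrite -prE//; exact: measurable_ev.
by rewrite setTI /pr probability_setT mul1r prs.
Qed.

Lemma revealed_sub {H} {F : pred keys} (F' : pred keys) :
  subpred F' F -> revealed H F -> revealed H F'.
Proof.
move=> F'F [mH HF]; split=> // s us /allP Fs; apply: HF => //.
by apply/allP => z /Fs/F'F.
Qed.

Lemma pr_revealedI {H F c} : revealed H F -> F (frog_key c) ->
  pr (H `&` ev c) = pr H * pr (ev c).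
Proof.
move=> [mH HF] Fc; have /= := HF [:: c].
by rewrite setIT Fc big_seq1; apply.
Qed.

Lemma pr_revealedD {H F c} : revealed H F -> F (frog_key c) ->
  pr (H `\` ev c) = pr H * (1 - pr (ev c)).
Proof.
move=> HF Fc; have [mH _] := HF.
have := pr_setDI mH (measurable_ev c).
rewrite (pr_revealedI HF Fc) => e.
by apply: (addIr (pr H * pr (ev c))); rewrite -e; ring.
Qed.

(** The product rule for [c :: s]: removing the key of [c] from [F] makes it differ from all keys of
    [s]. *)
Lemma revealed_key {H F c s} : revealed H F -> F (frog_key c) ->
  uniq (map (@frog_key N) s) ->
  all (predD1 F (frog_key c)) (map (@frog_key N) s) ->
  pr (H `&` ev c `&` cyl s) = pr H * pr (ev c) * \prod_(c <- s) pr (ev c).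
Proof.
move=> [mH HF] Fc us /allP Fs; rewrite -setIA (HF (c :: s))/=.
- by rewrite big_cons mulrA.
- by rewrite us andbT; apply/negP => /Fs /=; rewrite eqxx.
- by rewrite Fc; apply/allP => z /Fs /andP[].
Qed.

Lemma revealedI {H F c} : revealed H F -> F (frog_key c) ->
  revealed (H `&` ev c) (predD1 F (frog_key c)).
Proof.
move=> HF Fc; have [mH _] := HF.
split=> [|s us Fs]; first exact: measurableI (measurable_ev c).
by rewrite (revealed_key HF)// (pr_revealedI HF).
Qed.

(** Subtract the product rule for [H] and [ev c] from the one for [H]. This covers negative
    information, such as [eta v] differing from 0, which is not a single coordinate event. *)
Lemma revealedD {H F c} : revealed H F -> F (frog_key c) ->
  revealed (H `\` ev c) (predD1 F (frog_key c)).
Proof.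
move=> HF Fc; have [mH HF'] := HF.
split=> [|s us Fs]; first exact: measurableD (measurable_ev c).
rewrite (pr_revealedD HF)//.
have mHs : measurable (H `&` cyl s).
  by apply: measurableI => //; exact: measurable_cyl.
have := pr_setDI mHs (measurable_ev c).
rewrite setIAC (revealed_key HF)// setDE setIAC -setDE (HF' s)//.
  move=> e; apply: (addIr (pr H * pr (ev c) * \prod_(c <- s) pr (ev c))).
  by rewrite -e; ring.
by apply/allP => z /(allP Fs) /andP[].
Qed.

End Cylinders.

(** * Measurability of the number of visited vertices *)

Section Measurability.
Variables (d : measure_display) (T : measurableType d) (N : nat).
Variables (eta : 'I_N -> T -> option nat)
  (surv : 'I_N -> nat -> nat -> T -> bool)
  (jump : 'I_N -> nat -> nat -> T -> 'I_N.-1) (o : 'I_N).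
Hypothesis mev : forall c, measurable (frog_event eta surv jump c).

Let visited := frog_visited eta surv jump o.

Definition visited_count (t : T) : nat := #|[set v | `[< visited t v >]]|.

(** Visits graded by the length of the activation chain, which turns the inductive predicate into a
    countable union of events. *)
Fixpoint reach (m : nat) (t : T) (w : 'I_N) : Prop :=
  if m is m'.+1 then exists x : 'I_N * nat * nat,
    [/\ reach m' t x.1.1, frog_particle eta o x.1.1 x.1.2 t,
      forall i, (i <= x.2)%N -> surv x.1.1 x.1.2 i t &
      frog_pos jump x.1.1 x.1.2 t x.2.+1 = w]
  else w = o.

Lemma visitedE t w : visited t w <-> exists m, reach m t w.
Proof.
split=> [|[m]].
  elim=> [|v j k _ [m rv] pv sv]; first by exists 0%N.
  by exists m.+1, (v, j, k).
elim: m w => [w ->|m IH _ [x [/IH rx px sx <-]]].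
  exact: frog_visited_root.
exact: frog_visited_step.
Qed.

Lemma measurable_constant_prop (Q : Prop) : measurable [set t : T | Q].
Proof.
have [hQ|hQ] := pselect Q.
  by rewrite (_ : [set _ | _] = setT) //; apply/seteqP; split.
by rewrite (_ : [set _ | _] = set0) //; apply/seteqP; split.
Qed.

Lemma measurable_frog_pos v j k w :
  measurable [set t | frog_pos jump v j t k = w].
Proof.
elim: k w => [|k IH] w /=; first exact: measurable_constant_prop.
(* Split over the finitely many pairs of a previous position and a jump that lead to [w]. *)
rewrite (_ : [set _ | _] = \bigcup_(x in [set x | lift x.1 x.2 = w])
    ([set t | frog_pos jump v j t k = x.1] `&` [set t | jump v j k t = x.2])).
  apply: fin_bigcup_measurable => // x _; apply: measurableI => //.
  exact: mev (CJump v j k x.2).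
apply/seteqP; split=> [t /= <-|t [x /= <- [<- <-]]] //.
by exists (frog_pos jump v j t k, jump v j k t).
Qed.

Lemma measurable_frog_particle v j :
  measurable [set t | frog_particle eta o v j t].
Proof.
rewrite (_ : [set _ | _] = [set t | eta v t = None] `|`
    \bigcup_(e in [set e | (j < e + (v == o))%N]) [set t | eta v t = Some e]).
  apply: measurableU; first exact: mev (CEta v None).
  by apply: bigcup_measurable => e _; exact: mev (CEta v (Some e)).
rewrite /frog_particle; apply/seteqP; split=> t /=.
  by case Ee : eta => [e|] h; [right; exists e | left].
by case=> [->//|[e /= ? ->]].
Qed.

Lemma measurable_frog_surv v j k :
  measurable [set t | forall i, (i <= k)%N -> surv v j i t].
Proof.
rewrite (_ : [set _ | _] =
    \bigcap_(i in [set i | (i <= k)%N]) [set t | surv v j i t]) //.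
by apply: bigcap_measurableType => i _; exact: mev (CSurv v j i true).
Qed.

Lemma measurable_reach m w : measurable [set t | reach m t w].
Proof.
elim: m w => [|m IH] w /=; first exact: measurable_constant_prop.
rewrite (_ : [set _ | _] = \bigcup_(x : 'I_N * nat * nat)
    ([set t | reach m t x.1.1] `&`
    [set t | frog_particle eta o x.1.1 x.1.2 t] `&`
    [set t | forall i, (i <= x.2)%N -> surv x.1.1 x.1.2 i t] `&`
    [set t | frog_pos jump x.1.1 x.1.2 t x.2.+1 = w])).
  apply: countable_bigcupT_measurable => [|x]; first exact: countableP.
  apply: measurableI; last exact: measurable_frog_pos.
  apply: measurableI; last exact: measurable_frog_surv.
  apply: measurableI => //; exact: measurable_frog_particle.
by apply/seteqP; split=> t [x]; [case | move=> _ [[[]]]]; exists x.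
Qed.

Lemma measurable_visited w : measurable [set t | visited t w].
Proof.
rewrite (_ : [set _ | _] = \bigcup_m [set t | reach m t w]).
  by apply: bigcupT_measurable => m; exact: measurable_reach.
apply/seteqP; split=> t; first by move=> /visitedE[m rm]; exists m.
by case=> m _ rm; apply/visitedE; exists m.
Qed.

Lemma visited_countE t :
  visited_count t = #|finset (fun v => `[< visited t v >])|.
Proof.
rewrite /visited_count; apply: eq_card => v; rewrite [RHS]inE.
by apply/idP/idP => [/set_mem|h]; [|apply: mem_set].
Qed.

(** There are finitely many candidates [S] for the set of visited vertices, and each is cut out by
    finitely many visit events. *)
Lemma measurable_visited_count (B : set nat) :
  measurable [set t | B (visited_count t)].
Proof.
rewrite (_ : [set _ | _] = \bigcup_(S in [set S : {set 'I_N} | B #|S|])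
    \bigcap_v [set t | visited t v <-> v \in S]).
  apply: fin_bigcup_measurable => // S _.
  apply: fin_bigcap_measurable => // v _.
  case: (v \in S).
    rewrite (_ : [set _ | _] = [set t | visited t v]).
      exact: measurable_visited.
    by apply/seteqP; split=> t /=; [case=> _; exact | split].
  rewrite (_ : [set _ | _] = ~` [set t | visited t v]).
    by apply: measurableC; exact: measurable_visited.
  by apply/seteqP; split=> t /=; [case=> h _ /h | split].
apply/seteqP; split=> t.
  rewrite /= visited_countE => Bt.
  exists (finset (fun v => `[< visited t v >])) => //= v _.
  by rewrite inE; split=> [/asboolP|/asboolP].
case=> S /= BS tS; rewrite visited_countE (_ : finset _ = S)//.
apply/setP => v; rewrite inE; have /= tSv := tS v I.
by apply/idP/idP => [/asboolP/tSv|/tSv/asboolP].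
Qed.

End Measurability.

(** [lift x] runs over all vertices except [x], which lies in [W]; so every vertex outside [W] is
    hit exactly once, lowering its term from 1 to [r]. *)
Lemma sum_pow_lift (R : comNzRingType) n (W : {set 'I_n.+2}) x (r : R) :
  x \in W ->
  \sum_(y < n.+1) r ^+ (lift x y \notin W) = n.+1%:R - (1 - r) * #|~: W|%:R.
Proof.
move=> xW; have rE (a : bool) : r ^+ a = 1 - (1 - r) * a%:R.
  by case: a => /=; rewrite ?expr1 ?expr0; ring.
rewrite (eq_bigr _ (fun y _ => rE (lift x y \notin W))) sumrB.
rewrite big_const card_ord iter_addr_0 -mulr_sumr -natr_sum; congr (_ - _ * _%:R).
rewrite -sum1_card [RHS]big_mkcond (bigD1_ord x)//= inE xW add0n.
by apply: eq_bigr => y _; rewrite inE; case: (_ \in _).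
Qed.

(** * Exploration *)

Section Exploration.
Variables (R : realType) (d : measure_display) (T : measurableType d).
Variables (P : probability T R) (n : nat) (q : option nat -> R) (p eps : R).
Local Notation N := n.+2.
Variables (eta : 'I_N -> T -> option nat)
  (surv : 'I_N -> nat -> nat -> T -> bool)
  (jump : 'I_N -> nat -> nat -> T -> 'I_N.-1) (o : 'I_N).
Hypothesis law : frog_law P q p eta surv jump.
Hypothesis eps01 : 0 < eps < 1.
Hypothesis p01 : 0 < p <= 1.
Hypothesis q01 : 0 <= q (Some 0%N) < 1.

Let visited := frog_visited eta surv jump o.
Let ev := frog_event eta surv jump.
(** The value of q(0) + (1 - q(0)) B at B = 1/2, the threshold imposed on [b L]. *)
Let r := (1 + q (Some 0%N)) / 2.
Let c := 1 - eps * (1 - r).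
Let b (l : nat) := c ^+ l + l%:R * (1 - p).

Let bad := [set t |
  ~ ((1 - eps) * N%:R <= (visited_count eta surv jump o t)%:R)].

Let measurable_bad : measurable bad.
Proof.
apply: (measurable_visited_count o (measurable_ev law)
  [set k | ~ ((1 - eps) * N%:R <= k%:R)]).

Qed.

Let r01 : 0 < r < 1.
Proof. by move: q01 => /andP[q0 q1]; apply/andP; rewrite /r; split; lra. Qed.

Let c01 : 0 < c < 1.
Proof.
move: r01 eps01 => /andP[r0 r1] /andP[e0 e1].
by apply/andP; rewrite /c; split; nra.
Qed.

Let b_ge0 l : 0 <= b l.
Proof.
move: c01 p01 => /andP[/ltW c0 _] /andP[_ p1].
by rewrite addr_ge0 ?mulr_ge0 ?exprn_ge0// subr_ge0.
Qed.

(** * States of the exploration *)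

Definition untouched (A : {set 'I_N}) (z : nat * ('I_N * nat * nat)) :=
  z.2.1.1 \notin A.

(* The tag 0 belongs to eta v, which is revealed before particle 0 of v moves. *)
Definition unwalked A (v : 'I_N) (k : nat) (z : nat * ('I_N * nat * nat)) :=
  untouched A z || [&& z.2.1.1 == v, (0 < z.1)%N & (k <= z.2.2)%N].

(** The state between two walks. All keys of [A] are given up, so the lengths of past walks need not
    be recorded. *)
Definition idle (A W : {set 'I_N}) (H : set T) :=
  [/\ A \subset W, H `<=` [set t | forall w, w \in W -> visited t w] &
    revealed P eta surv jump H (untouched A)].

(** The state during a walk: particle 0 of [v] has made [k] steps and stands at [x]. *)
Definition walking (A W : {set 'I_N}) v k x (H : set T) :=
  [/\ [/\ A \subset W, v \in A & x \in W],
    H `<=` [set t | forall w, w \in W -> visited t w],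
    H `<=` [set t | [/\ frog_particle eta o v 0 t,
      forall i, (i < k)%N -> surv v 0 i t & frog_pos jump v 0 t k = x]] &
    revealed P eta surv jump H (unwalked A v k)].

Let Pr := pr P.

Lemma walking_idle A W v k x H : walking A W v k x H -> idle A W H.
Proof.
move=> [[AW _ _] HW _ HF]; split=> //.
by apply: revealed_sub HF => z uz; rewrite /= /unwalked uz.
Qed.

Lemma bad_large (W : {set 'I_N}) (H : set T) :
  H `<=` [set t | forall w, w \in W -> visited t w] ->
  (1 - eps) * N%:R <= #|W|%:R :> R -> bad `&` H = set0.
Proof.
move=> HW largeW; rewrite -subset0 => t [+ /HW /= Wt]; apply.
rewrite (le_trans largeW)// ler_nat visited_countE subset_leq_card//.
by apply/fintype.subsetP => w /Wt wt; rewrite inE; apply/asboolP.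
Qed.

(** * Failure bounds along the exploration *)

Lemma step_average (W : {set 'I_N}) x : x \in W ->
  #|W|%:R < (1 - eps) * N%:R :> R ->
  \sum_(y < n.+1) r ^+ (lift x y \notin W) * n.+1%:R^-1 <= c.
Proof.
move=> xW smallW; rewrite -mulr_suml sum_pow_lift// ler_pdivrMr ?ltr0n//.
have : #|W|%:R + #|~: W|%:R = N%:R :> R by rewrite -natrD cardsC card_ord.
have : 0 <= n%:R :> R by [].
have NR : N%:R = n%:R + 2 :> R by rewrite -addn2 natrD.
have N1R : n.+1%:R = n%:R + 1 :> R by rewrite -addn1 natrD.
move: smallW r01 eps01; rewrite /c NR N1R.
move: (#|W|%:R : R) (#|~: W|%:R : R) (n%:R : R) => w z k.
move=> sW /andP[_ r1] /andP[e0 e1] k0 e.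
(* [k + 1] is N - 1, the number of possible jumps, and [z] the number of vertices outside [W]. *)
have {}sW : eps * (k + 1) <= z by nra.
have : 0 <= (1 - r) * (z - eps * (k + 1)) by rewrite mulr_ge0 ?subr_ge0// ltW.
nra.
Qed.

(** Induction on the number [l] of steps left. [A] stays fixed during a walk, so the idle bound for
    this one [A] handles the end of the walk, by death or at [l = 0]. *)
Lemma walking_bound (A : {set 'I_N}) :
  (forall W H, idle A W H -> Pr (bad `&` H) <= Pr H * r ^+ #|W :\: A|) ->
  forall l W v k x H, walking A W v k x H ->
  Pr (bad `&` H) <= Pr H * (r ^+ #|W :\: A| * b l).
Proof.
move=> idle_bound; elim=> [|l IH] W v k x H wH.
  by rewrite /b expr0 mul0r addr0 mulr1 idle_bound//; exact: walking_idle wH.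
have [largeW|smallW] := leP ((1 - eps) * N%:R) (#|W|%:R : R).
  have [_ HW _ _] := wH.
  rewrite (bad_large HW)// /Pr /pr measure0 mulr_ge0 ?pr_ge0//.
  by rewrite mulr_ge0// exprn_ge0//; move: r01 => /andP[/ltW].
have [[AW vA xW] HW Hv HF] := wH; have [mH _] := HF.
pose S := ev (CSurv v 0 k true); pose J y := ev (CJump v 0 k y).
have Skey : unwalked A v k (frog_key (CSurv v 0 k true)).
  by rewrite /unwalked /= eqxx leqnn orbT.
have mS : measurable S := measurable_ev law _.
have HSF := revealedI law HF Skey.
have Jkey y : predD1 (unwalked A v k) (frog_key (CSurv v 0 k true))
    (frog_key (CJump v 0 k y)).
  by rewrite /= /unwalked /= eqxx leqnn orbT.
(* A death leads to an idle state with the same [W]; the coin belongs to [v] in [A], so no untouched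
   key is spent. *)
have dies : Pr (bad `&` (H `\` S)) <= Pr H * (1 - p) * r ^+ #|W :\: A|.
  rewrite -(pr_surv law v 0 k).
  rewrite -(pr_revealedD law HF Skey).
  apply: idle_bound; split=> //; first by move=> t [/HW].
  apply: revealed_sub (revealedD law HF Skey) => z zA /=.
  rewrite /unwalked zA andbT; apply: contraNneq zA => ->.
  by rewrite /untouched /= vA.
(* The landing vertex joins [W], which gains a factor [r] exactly when it is new. *)
have jumps y : Pr (bad `&` (H `&` S `&` J y)) <=
    Pr H * p * r ^+ #|W :\: A| * b l * (r ^+ (lift x y \notin W) * n.+1%:R^-1).
  have cardW' : #|(lift x y |: W) :\: A| = ((lift x y \notin W) + #|W :\: A|)%N.
    case: (boolP (_ \in W)) => [yW|yW].
      by rewrite (finset.setUidPr _)// finset.sub1set.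
    have yA : lift x y \notin A.
      by apply: contra yW; exact: (fintype.subsetP AW).
    rewrite finset.setDUl [X in X :|: _](_ : _ = [set (lift x y)]%SET).
      by rewrite finset.cardsU1 inE (negPf yW) andbF.
    by apply/finset.setP => w; rewrite !inE andbC; case: eqP => // ->; rewrite yA.
  have prJ : Pr (H `&` S `&` J y) = Pr H * p * n.+1%:R^-1.
    rewrite /Pr (pr_revealedI HSF (Jkey y)).
    rewrite (pr_revealedI HF Skey).
    by rewrite (pr_surv law) (pr_jump law).
  rewrite (_ : _ * _ =
      Pr (H `&` S `&` J y) * (r ^+ #|(lift x y |: W) :\: A| * b l)).
    apply: (IH _ v k.+1 (lift x y)); split.
    - split=> //; last by rewrite finset.setU11.
      exact: fintype.subset_trans AW (finset.subsetUr _ _).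
    - move=> t [[Ht St] Jt] w; rewrite in_setU1.
      move=> /predU1P[->|wW]; last exact: HW.
      have [pv sv posv] := Hv t Ht.
      rewrite -posv -[y]Jt; apply: (@frog_visited_step _ _ _ _ _ _ _ v 0 k) => //.
        exact/HW/(fintype.subsetP AW).
      by move=> i; rewrite leq_eqVlt => /predU1P[->|/sv].
    - move=> t [[Ht St] Jt]; have [pv sv posv] := Hv t Ht; split=> //=.
        by move=> i /ltnSE; rewrite leq_eqVlt => /predU1P[->|/sv].
      by rewrite posv Jt.
    - apply: revealed_sub (revealedI law HSF (Jkey y)) => z /=.
      rewrite /unwalked => /orP[zA|/and3P[-> -> kz]].
        rewrite zA !andbT; apply/andP; split; apply: contraNneq zA => ->;
        by rewrite /untouched /= vA.
      rewrite (ltnW kz) orbT andbT; apply/andP.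
      by split; apply: contraTneq kz => -> /=; rewrite ltnn.
  rewrite prJ cardW' exprD; ring.
have -> : Pr (bad `&` H) = Pr (bad `&` (H `\` S)) +
    \sum_(y < n.+1) Pr (bad `&` (H `&` S `&` J y)).
  rewrite /Pr (pr_setDI P (measurableI _ _ measurable_bad mH) mS).
  rewrite setDE -setIA -setDE -setIA; congr (_ + _).
  have mbHS := measurableI _ _ measurable_bad (measurableI _ _ mH mS).
  have mJ y : measurable [set t | jump v 0 k t = y].
    exact: measurable_ev law (CJump v 0 k y).
  rewrite (pr_fibers P mbHS mJ).
  by apply: eq_bigr => y _; rewrite -setIA.
rewrite (le_trans (lerD dies (ler_sum _ (fun y _ => jumps y))))// -mulr_sumr.
have Hr_ge0 : 0 <= Pr H * r ^+ #|W :\: A|.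
  by rewrite mulr_ge0 ?pr_ge0 ?exprn_ge0//; move: r01 => /andP[/ltW].
have := step_average xW smallW; set avg := \sum_(y < _) _ => avg_le.
(* The recursion behind [b]: a step costs 1 - p for a death and multiplies the rest by at most [c],
   whose effect on the linear term is dropped. *)
have bS : 1 - p + p * (b l * avg) <= b l.+1.
  move: p01 c01 => /andP[/ltW p0 p1] /andP[/ltW c0 /ltW c1].
  have : p * (b l * avg) <= b l * c.
    rewrite (le_trans (ler_wpM2l p0 (ler_wpM2l (b_ge0 l) avg_le)))//.
    by rewrite ler_piMl// mulr_ge0.
  have : l%:R * (1 - p) * c <= l%:R * (1 - p).
    by rewrite ler_piMr// mulr_ge0// subr_ge0.
  rewrite /b exprS -[l.+1]addn1 natrD; lra.
rewrite mulrA (le_trans _ (ler_wpM2l Hr_ge0 bS))// le_eqVlt; apply/orP; left.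
by apply/eqP; ring.
Qed.

(** Induction on the number of vertices outside [A]: a vertex [v] of [W] outside [A] is moved into
    [A] and [eta v] is revealed. *)
Lemma idle_bound L : b L <= 1 / 2 -> forall A W H, idle A W H ->
  Pr (bad `&` H) <= Pr H * r ^+ #|W :\: A|.
Proof.
move=> bL A; have [m] := ubnP #|~: A|.
elim: m A => // m IHm A /ltnSE leAm W H iH.
have [AW HW HF] := iH; have [mH _] := HF.
have [u0|] := posnP #|W :\: A|.
  by rewrite u0 expr0 mulr1 pr_le//; exact: measurableI.
rewrite card_gt0 => /set0Pn[v]; rewrite finset.in_setD => /andP[vA vW].
pose E := ev (CEta v (Some 0%N)); pose A' := (v |: A)%SET.
have mE : measurable E := measurable_ev law _.
have Ekey : untouched A (frog_key (CEta v (Some 0%N))) by [].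
have A'W : A' \subset W by rewrite finset.subUset finset.sub1set vW.
have cardA' : #|W :\: A| = #|W :\: A'|.+1.
  rewrite (finset.cardsD1 v) finset.in_setD vA vW; congr _.+1.
  by apply: eq_card => w; rewrite !inE negb_or andbA.
have IH W' H' : idle A' W' H' ->
    Pr (bad `&` H') <= Pr H' * r ^+ #|W' :\: A'|.
  apply: IHm W' H'; apply: leq_trans leAm; rewrite proper_card// properE.
  rewrite finset.setCS finset.subsetUr /= finset.setCS; apply/negP.
  by move=> /fintype.subsetP/(_ v); rewrite finset.setU11 (negPf vA) => /(_ isT).
have asleep : Pr (bad `&` (H `&` E)) <= Pr H * q (Some 0%N) * r ^+ #|W :\: A'|.
  rewrite -(pr_eta law v) -(pr_revealedI HF Ekey); apply: IH.
  split=> //; first by move=> t [/HW].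
  apply: revealed_sub (revealedI law HF Ekey) => z /=.
  rewrite /untouched !inE negb_or => /andP[zv ->]; rewrite andbT.
  by apply: contraNneq zv => ->.
have walks : Pr (bad `&` (H `\` E)) <=
    Pr H * (1 - q (Some 0%N)) * (r ^+ #|W :\: A'| * b L).
  rewrite -(pr_eta law v) -(pr_revealedD law HF Ekey).
  apply: (@walking_bound A' IH L W v 0%N v); split.
  - by rewrite finset.setU11.
  - by move=> t [/HW].
  (* Particle 0 exists as soon as [eta v] is not 0, be it finite or infinite. *)
  - move=> t [_ nE]; split=> //; rewrite /frog_particle.
    by case e : (eta v t) nE => [[|]|] //; case; exact: e.
  - apply: revealed_sub (revealedD law HF Ekey) => z /=.
    rewrite /unwalked /untouched !inE negb_or => /orP[/andP[zv ->]|].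
      by rewrite andbT; apply: contraNneq zv => ->.
    move=> /and3P[/eqP -> z0 _]; rewrite vA andbT.
    by apply: contraTneq z0 => ->.
rewrite /Pr (pr_setDI P (measurableI _ _ measurable_bad mH) mE).
rewrite setDE -setIA -setDE -setIA (le_trans (lerD walks asleep))//.
rewrite cardA' exprS -/(Pr H).
have : 0 <= Pr H * r ^+ #|W :\: A'|.
  by rewrite mulr_ge0 ?pr_ge0 ?exprn_ge0//; move: r01 => /andP[/ltW].
move: (r ^+ _) => s; move: bL q01; move: (b L) (Pr H) => B h bL /andP[q0 q1] hs.
(* This is q(0) + (1 - q(0)) B <= r, multiplied by [h * s]. *)
have : 0 <= h * s * (1 - q (Some 0%N)) * (1 / 2 - B).
  apply: mulr_ge0; last by rewrite subr_ge0.
  by apply: mulr_ge0 => //; rewrite subr_ge0 ltW.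
rewrite /r; lra.
Qed.

(** Start in the walking state with [A] and [W] both equal to the root: its extra particle exists
    whatever [eta o] is, so nothing is revealed. The first walk may have any length [M]; later ones
    use [L]. *)
Lemma pr_bad L M : c ^+ L + L%:R * (1 - p) <= 1 / 2 ->
  Pr bad <= c ^+ M + M%:R * (1 - p).
Proof.
move=> bL; rewrite -[bad]setIT.
have := @walking_bound [set o]%SET (@idle_bound L bL _) M
  [set o]%SET o 0%N o setT.
rewrite finset.setDv cards0 expr0 mul1r /Pr {2}/pr probability_setT mul1r; apply.
split=> //.
- by rewrite inE.
- by move=> t _ w; rewrite inE => /eqP ->; exact: frog_visited_root.
- move=> t _; split=> //; rewrite /frog_particle eqxx; case: (eta o t) => // e.
  by rewrite addn1.
- by apply: revealed_sub (revealed_setT law).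
Qed.

End Exploration.

(** * Choice of the constants and passage to the limit *)

Lemma expr_linear_small (R : realType) (c e : R) (u : nat -> R) :
  0 < c < 1 -> 0 < e -> u @ \oo --> (1 : R) ->
  exists L, \forall m \near \oo, c ^+ L + L%:R * (1 - u m) <= e.
Proof.
move=> /andP[c0 c1] e0 u1; have e20 : 0 < e / 2 by rewrite divr_gt0.
have cL : (fun L => c ^+ L) @ \oo --> (0 : R).
  by apply: cvg_expr; rewrite gtr0_norm.
have [L _ /(_ L (leqnn L)) /= cLe] := (cvgrPdist_le _ _).1 cL _ e20.
(* [L] already makes the power at most e/2; dividing by [L.+1] rather than [L] allows [L = 0]. *)
exists L; have e'0 : 0 < e / 2 / L.+1%:R by rewrite divr_gt0.
near=> m.
have um : `|1 - u m| <= e / 2 / L.+1%:R.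
  by near: m; exact: (cvgrPdist_le _ _).1 u1 _ e'0.
have : c ^+ L <= e / 2 by rewrite (le_trans _ cLe)// sub0r normrN ler_norm.
have : L%:R * (1 - u m) <= e / 2.
  rewrite ler_pdivlMr ?ltr0n// in um.
  have Lu : L%:R * (1 - u m) <= L.+1%:R * `|1 - u m|.
    rewrite (le_trans (ler_wpM2l _ (ler_norm _)))//.
    by rewrite ler_wpM2r// ler_nat.
  by rewrite (le_trans Lu)// mulrC.
lra.
Unshelve. all: end_near. Qed.

Unset Implicit Arguments.

(* Index m corresponds to the complete graph K_n with n = m+2 vertices. *)
Theorem theorem1p1 (R : realType) (d : measure_display)
  (q : option nat -> R) (p : nat -> R) (eps : R)
  (T : nat -> measurableType d) (P : forall m, probability (T m) R)
  (o : forall m, 'I_m.+2)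
  (eta : forall m, 'I_m.+2 -> T m -> option nat)
  (surv : forall m, 'I_m.+2 -> nat -> nat -> T m -> bool)
  (jump : forall m, 'I_m.+2 -> nat -> nat -> T m -> 'I_m.+1) :
  q (Some 0%N) < 1 ->
  (forall n, 0 < p n <= 1) ->
  p @ \oo --> (1 : R) ->
  0 < eps < 1 ->
  (forall m, frog_law (P m) q (p m.+2) (eta m) (surv m) (jump m)) ->
  (fun m => P m [set t | (1 - eps) * m.+2%:R <=
      (frog_V (q None) (p m.+2) (eta m) (surv m) (jump m) (o m) t)%:R])
    @ \oo --> (1%E : \bar R).
Proof.
move=> q1 p01 pcvg eps01 law.
pose r := (1 + q (Some 0%N)) / 2; pose c := 1 - eps * (1 - r).
have q0 : 0 <= q (Some 0%N) by rewrite -(pr_eta (law 0%N) ord0) pr_ge0.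
have c01 : 0 < c < 1.
  move: eps01 => /andP[e0 e1]; have r0 : 0 < r by rewrite /r; lra.
  have r1 : r < 1 by rewrite /r; lra.
  by apply/andP; rewrite /c; split; nra.
have pcvg2 : (fun m => p m.+2) @ \oo --> (1 : R) 
  by move: pcvg; rewrite -(cvg_shiftn 2); under eq_fun do rewrite addn2.
pose good m := [set t | (1 - eps) * m.+2%:R <=
  (frog_V (q None) (p m.+2) (eta m) (surv m) (jump m) (o m) t)%:R].
have mgood m : measurable (good m).
  rewrite /good /frog_V; case: ((0 < q None) || (p m.+2 == 1)).
    exact: measurable_constant_prop.
  exact: (measurable_visited_count (o m) (measurable_ev (law m))
    [set k | ((1 - eps) * m.+2%:R <= k%:R)]).
have good_bounds m L M : c ^+ L + L%:R * (1 - p m.+2) <= 1 / 2 ->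
    1 - (c ^+ M + M%:R * (1 - p m.+2)) <= pr (P m) (good m) <= 1.
  move=> bL; have := pr_bad (o m) (law m) eps01 (p01 m.+2) _ M bL.
  rewrite q0 q1 => /(_ isT); set bad := [set t | ~ _] => le_bad.
  have mbad : measurable bad.
    exact: (measurable_visited_count (o m) (measurable_ev (law m))
      [set k | ~ ((1 - eps) * m.+2%:R <= k%:R)]).
  (* The convention in [frog_V] can only raise the count, to the total number of vertices, so both
     cases are covered. *)
  have bad_good : ~` bad `<=` good m.
    move=> t /contrapT /le_trans; apply; rewrite ler_nat /frog_V.
    case: ifP => // _; rewrite /visited_count.
    by apply: leq_trans (max_card _) (eq_leq (card_ord _)).
  apply/andP; split; last first.
    by rewrite -lee_fin -(prE _ (mgood m)) probability_le1.
  have := pr_le (P m) (measurableC mbad) (mgood m) bad_good.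
  have := pr_setDI (P m) measurableT mbad.
  rewrite setTI setTD {1}/pr probability_setT /=; lra.
(* [L] is fixed once for the threshold 1/2; only [M] below depends on the precision [e]. *)
have [L bL] : exists L, \forall m \near \oo,
    c ^+ L + L%:R * (1 - p m.+2) <= 1 / 2.
  exact: expr_linear_small.
have -> : (fun m => P m (good m)) = (fun m => (pr (P m) (good m))%:E).
  by apply/funext => m; rewrite -(prE _ (mgood m)).
apply/fine_cvgP; split; first exact: nearW.
apply/cvgrPdist_le => e e0; have [M bM] := expr_linear_small c01 e0 pcvg2.
near=> m.
have /andP[lo hi] :
    1 - (c ^+ M + M%:R * (1 - p m.+2)) <= pr (P m) (good m) <= 1.
  by apply: good_bounds; near: m; exact: bL.
have : c ^+ M + M%:R * (1 - p m.+2) <= e by near: m; exact: bM.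
by move=> /= ?; rewrite ger0_norm ?subr_ge0//; lra.
Unshelve. all: end_near. Qed.
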